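(* Let $\mathbb{F}$ be a finite field with $q$ elements and let $D\in\mathbb{F}[x]$ be a positive polynomial. Then Pell's equation $$u^2+Dv^2=1$$ has a nontrivial solution $(u,v)$ with $\deg(u),\deg(v)\le q^{\deg(D)}$.
   Context: Solutions $(u,v)$ are sought with $u,v$ in the polynomial ring $\mathbb{F}[x]$, and $\deg(p)$ denotes the degree of a polynomial $p\in\mathbb{F}[x]$. A polynomial $D\in\mathbb{F}[x]$ is called positive if it is neither constant nor a square, has even degree, and its highest coefficient is a square. A solution $(u,v)$ of the equation is called trivial if $u,v\in\mathbb{F}$, and nontrivial otherwise.
   Formalization: For u²+Dv²=1 the claim is proved only for q≡1 mod 4, since for q even or q≡3 mod 4 every positive D has only trivial solutions (e.g. q=3, D=x²+1). With the sign corrected to u²−Dv²=1, it is proved for all odd q, with the same degree bounds. *)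

(* Defs.v *)
From HB Require Import structures.
From mathcomp Require Import all_boot all_order all_algebra.

Set Implicit Arguments.
Unset Strict Implicit.
Unset Printing Implicit Defensive.

Import GRing.Theory.
Local Open Scope ring_scope.

(* The zero polynomial gets degree 0. *)
Definition deg (R : nzRingType) (p : {poly R}) : nat := (size p).-1.

Definition is_const (R : nzRingType) (p : {poly R}) : Prop :=
  exists c : R, p = c%:P.

Definition is_square (R : nzRingType) (a : R) : Prop :=
  exists b : R, a = b ^+ 2.

Definition positive (F : fieldType) (D : {poly F}) : Prop :=
  [/\ ~ is_const D, ~ is_square D, ~~ odd (deg D) & is_square (lead_coef D)].

Definition trivial_solution (F : fieldType) (u v : {poly F}) : Prop :=
  is_const u /\ is_const v.

(* Main.v *)
Require Import Defs.
From mathcomp Require Import all_boot all_order all_algebra.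
From mathcomp Require Import fingroup cyclic finfield.
From mathcomp Require Import zify ring.

Set Implicit Arguments.
Unset Strict Implicit.
Unset Printing Implicit Defensive.

Import GRing.Theory.
Local Open Scope ring_scope.

(** A Pell solution is a quotient of two elements a + b sqrt D of equal norm, and
    such pairs are found by a pigeonhole argument on Diophantine approximations
    of sqrt D.

    Let D have degree 2d, and work in characteristic other than 2. As the leading
    coefficient of D is a square, sqrt D is a Laurent series in 1/x of degree d.
    It is replaced by a polynomial s close to t sqrt D, where t = x^M for a large
    fixed M ([poly_sqrt_approx]). Linear algebra gives, for each n <= M / 2,
    coprime a and b with deg b <= n and deg (b s - a t) < M - n
    ([coprime_dirichlet_approx]), so that a - b sqrt D has degree below -n. Its
    product with a + b sqrt D, the norm Q = a^2 - D b^2, is then a nonzero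
    polynomial of degree at most d - 1 - (n - deg b) ([size_norm_approx]).

    If two approximations (a, b) and (a', b') have the same norm Q and the same
    residue P = a/b = a'/b' modulo Q, then (a + b sqrt D) / (a' + b' sqrt D) is of
    the form u + v sqrt D with u and v polynomials, and its norm is 1. The
    solution is not trivial as soon as deg b <> deg b', and
    v Q = a' b - a b' has small degree because both approximations are good.

    The bound comes from an economical choice of pigeonholes: to n is attached
    Q, P and the defect r = n - deg b. Two different n in the same hole have
    different deg b, and the distance between them bounds deg v. Since
    deg P < deg Q and deg Q + r < d, the data P and r fit together
    in the single polynomial B = x^(deg Q + r) + P of degree less than d, so that
    the pairs (Q, B) with B nonzero fill at most N = q^d (q^d - 1) holes. This
    gives deg v < N, and deg u = d + deg v leaves room below q^(2d).

    When q = 1 modulo 4, -1 is the square of some i in F, and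
    (u, v) |-> (u, i v) turns solutions of u^2 - D v^2 = 1 into solutions of
    u^2 + D v^2 = 1. *)

(** * Finite fields of odd order *)

(** By Lagrange in the additive group, #|F| copies of 1 add up to 0; if 2 = 0 and
    #|F| is odd, they also add up to 1. *)
Lemma two_neq0_odd_card (F : finFieldType) : odd #|F| -> 2%:R != 0 :> F.
Proof.
move=> oddF; apply/eqP=> two0.
have card0 : (1 : F) *+ #|F| = 0.
  by have := expg_cardG (in_setT (1 : F)); rewrite cardsT FinRing.zmodXgE.
have := card0; rewrite -(odd_double_half #|F|) oddF mulrnDr -muln2 mulnC mulrnA.
by rewrite two0 mul0rn addr0 => /eqP; rewrite oner_eq0.
Qed.

(** Write #|F| - 1 = 2h with h even. Every x <> 0 has x^h = 1 or x^h = -1, and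
    X^h - 1 has too few roots for the first case to hold always; an x with
    x^h = -1 gives the square root x^(h/2) of -1. *)
Lemma sqrt_opp1 (F : finFieldType) :
  #|F| = 1 %[mod 4] -> exists i : F, i ^+ 2 = -1.
Proof.
move=> F1mod4.
pose h := (#|F| %/ 4).*2.
have cardF : #|F| = h.*2.+1 by rewrite /h; lia.
have h_gt0 : (0 < h)%N by have : (1 < #|F|)%N by [exact: finNzRing_gt1]; lia.
have [x /eqP xh | noroot] := pickP (fun x : F => x ^+ h == -1).
  by exists (x ^+ (#|F| %/ 4)); rewrite -exprM muln2.
have all1 (x : F) : x != 0 -> x ^+ h = 1.
  move=> x0; have := expf_card x; rewrite cardF exprS -[RHS]mulr1.
  move=> /(mulfI x0); rewrite -muln2 exprM => /eqP; rewrite sqrf_eq1.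
  by rewrite (noroot x) orbF => /eqP.
have := @max_poly_roots _ ('X^h - 1) (enum [set~ (0 : F)]).
rewrite size_XnsubC // -size_poly_eq0 size_XnsubC // enum_uniq -cardE cardsC1.
move=> /(_ isT) roots; suff : (#|F|.-1 < h.+1)%N by lia.
apply: roots => //; apply/allP => x; rewrite mem_enum !inE => x0.
by rewrite rootE !hornerE all1 // subrr.
Qed.

(** * Sizes of polynomial expressions *)

(* [size_mul] with its sizes read through the structure of F as a field instead of
   an integral domain; the two readings are convertible but not identical. *)
Lemma size_polyM (F : fieldType) (p q : {poly F}) :
  p != 0 -> q != 0 -> size (p * q) = (size p + size q).-1.
Proof. exact: size_mul. Qed.

Lemma leq_size_polyM (F : fieldType) (p q : {poly F}) (m n : nat) :
  (size p <= m -> size q <= n -> size (p * q)%R <= (m + n).-1)%N.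
Proof. by have := size_polyMleq p q; lia. Qed.

Lemma leq_size_polyD (F : fieldType) (p q : {poly F}) (m : nat) :
  (size p <= m -> size q <= m -> size (p + q)%R <= m)%N.
Proof. by have := size_polyD p q; lia. Qed.

Lemma leq_size_polyB (F : fieldType) (p q : {poly F}) (m : nat) :
  (size p <= m -> size q <= m -> size (p - q)%R <= m)%N.
Proof. by move=> sp sq; apply: leq_size_polyD; rewrite ?size_polyN. Qed.

(** * Approximation of square roots and of fractions *)

(** The polynomial part of the square root of E. Its coefficients are found
    from the top down: the one of x^m is the solution of a linear equation
    with leading factor 2c, which makes the coefficient of x^(k+m) in
    s^2 - E vanish. *)
Lemma poly_sqrt_approx (F : fieldType) (E : {poly F}) (k : nat) (c : F) :
  2%:R != 0 :> F -> size E = k.*2.+1 -> lead_coef E = c ^+ 2 ->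
  exists s : {poly F}, (size s <= k.+1)%N /\ (size (s ^+ 2 - E)%R <= k)%N.
Proof.
move=> two0 sizeE lcE.
have c0 : c != 0.
  by rewrite -(sqrf_eq0 c) -lcE lead_coef_eq0 -size_poly_eq0 sizeE.
suff : forall j, (j <= k)%N -> exists s : {poly F},
    [/\ (size s <= k.+1)%N, s`_k = c & (size (s ^+ 2 - E)%R <= k.*2 - j)%N].
  case/(_ k (leqnn k)) => s [ss _ sE]; exists s; split=> //.
  by rewrite (leq_trans sE) // -addnn addnK.
elim=> [_|j IHj lt_jk].
  exists (c *: 'X^k); split.
  - by rewrite (leq_trans (size_scale_leq _ _)) ?size_polyXn.
  - by rewrite !coefE eqxx mulr1.
  apply/leq_sizeP => i; rewrite subn0 leq_eqVlt => /predU1P[<-|lt_ki].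
    have := lcE; rewrite lead_coefE sizeE /= => Ek.
    by rewrite exprZn -exprM muln2 !coefE eqxx mulr1 Ek subrr.
  rewrite exprZn -exprM muln2 !coefE gtn_eqF // mulr0 sub0r.
  by rewrite nth_default ?oppr0 // sizeE.
have [s [ss sk sE]] := IHj (ltnW lt_jk).
pose m := (k - j.+1)%N; pose e := (s ^+ 2 - E)`_(k + m).
pose t := - e / (2%:R * c).
have sq : (s + t *: 'X^m) ^+ 2 - E =
    (s ^+ 2 - E) + (2%:R * t) *: (s * 'X^m) + (t ^+ 2) *: 'X^(m.*2).
  rewrite -muln2 exprM -!mul_polyC !rmorphM /= !rmorph_nat; ring.
exists (s + t *: 'X^m); split.
- rewrite (leq_trans (size_polyD _ _)) // geq_max ss.
  by rewrite (leq_trans (size_scale_leq _ _)) ?size_polyXn // ltnS leq_subr.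
- by rewrite !coefE gtn_eqF ?mulr0 ?addr0 // /m; lia.
apply/leq_sizeP => i le_i; rewrite sq 2!coefD !coefZ coefXn coefMXn.
have -> : (i == m.*2) = false by rewrite /m; lia.
have -> : (i < m)%N = false by rewrite /m; lia.
rewrite mulr0 addr0; move: le_i; rewrite leq_eqVlt => /predU1P[|lt_i].
  have -> : (k.*2 - j.+1 = k + m)%N by rewrite /m; lia.
  by move<-; rewrite addnK -/e sk /t; field; rewrite c0 two0.
rewrite !nth_default ?mulr0 ?addr0 //.
  by apply: leq_trans ss _; rewrite /m; lia.
by apply: leq_trans sE _; lia.
Qed.

(** Dirichlet's theorem for the fraction s / t: making the n top coefficients of
    b s mod t vanish imposes n linear conditions on the n + 1 coefficients
    of b. *)
Lemma dirichlet_approx (F : fieldType) (s t : {poly F}) (n : nat) :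
  (n < size t)%N ->
  exists a b : {poly F}, [/\ b != 0, (size b <= n.+1)%N
    & (size (b * s - a * t)%R + n < size t)%N].
Proof.
move=> lt_nt; have t0 : t != 0 by rewrite -size_poly_gt0; lia.
pose m := (size t).-1.
pose A := \matrix_(i < n.+1, j < n) (('X^i * s) %% t)`_(m - n + j).
have kA : kermx A != 0.
  by rewrite -mxrank_eq0 mxrank_ker; have := rank_leq_col A; lia.
have /rowV0Pn[w /sub_kermxP wA w0] := kA.
pose b := rVpoly w.
have bE : b = \sum_(i < n.+1) w 0 i *: 'X^i.
  by rewrite /b /rVpoly poly_def; apply: eq_bigr => i _; rewrite valK.
exists ((b * s) %/ t), b; split.
- by apply: contraNneq w0 => b0; rewrite -(rVpolyK w) -/b b0 linear0.
- exact: size_poly.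
pose r : {poly F} := (b * s) %% t.
have -> : b * s - b * s %/ t * t = r.
  by rewrite {1}(divp_eq (b * s) t) addrC addKr.
have szm : (size r <= m)%N.
  by rewrite -ltnS prednK ?ltn_modp ?size_poly_gt0.
suff : (size r <= m - n)%N by rewrite /m; lia.
apply/leq_sizeP => i le_i; have [lt_im|le_mi] := ltnP i m; last first.
  by rewrite nth_default // (leq_trans szm).
have lt_in : (i - (m - n) < n)%N by rewrite /m in lt_im *; lia.
move/rowP: wA => /(_ (Ordinal lt_in)); rewrite !mxE => wAi.
rewrite -[RHS]wAi /r bE mulr_suml.
rewrite (@big_morph _ _ (fun p => (p %% t)`_i) 0 +%R 0 +%R); first last.
- by rewrite mod0p coef0.
- by move=> p q; rewrite modpD coefD.
apply: eq_bigr => l _; rewrite !mxE -scalerAl modpZl coefZ /=.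
by rewrite subnKC.
Qed.

(** Dividing a and b by their gcd keeps the approximation good. *)
Lemma coprime_dirichlet_approx (F : fieldType) (s t : {poly F}) (n : nat) :
  (n < size t)%N ->
  exists a b : {poly F}, [/\ b != 0, coprimep a b, (size b <= n.+1)%N
    & (size (b * s - a * t)%R + n < size t)%N].
Proof.
move=> /(@dirichlet_approx _ s)[a [b [b0 sb sab]]].
pose g : {poly F} := gcdp a b.
have aE : a = a %/ g * g by rewrite divpK ?dvdp_gcdl.
have bE : b = b %/ g * g by rewrite divpK ?dvdp_gcdr.
have g0 : g != 0 by rewrite gcdp_eq0 (negPf b0) andbF.
exists (a %/ g), (b %/ g); split.
- by apply: contraNneq b0 => bg0; rewrite bE bg0 mul0r.
- by apply: coprimep_div_gcd; rewrite b0 orbT.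
- exact: leq_trans (leq_divp _ _) sb.
apply: leq_ltn_trans sab; rewrite leq_add2r {2}aE {2}bE.
pose e : {poly F} := b %/ g * s - a %/ g * t; rewrite -/e.
have -> : b %/ g * g * s - a %/ g * g * t = e * g by rewrite /e; ring.
have [->|e0] := eqVneq e 0; first by rewrite size_poly0.
have g_gt0 : (0 < size g)%N by rewrite size_poly_gt0.
by rewrite size_polyM //; lia.
Qed.

(** * Norms from the quadratic extension generated by the square root of D *)

Lemma norm_neq0 (F : fieldType) (D a b : {poly F}) :
  ~ is_square D -> b != 0 -> coprimep a b -> a ^+ 2 - D * b ^+ 2 != 0.
Proof.
move=> Dsq b0 cab; apply/eqP => /eqP; rewrite subr_eq0 => /eqP aD.
have : b ^+ 2 %| a ^+ 2 by rewrite aD dvdp_mull.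
rewrite dvdp_pexp2r // => /dvdpP[e aE]; case: Dsq; exists e.
by apply: (mulIf (expf_neq0 2 b0)); rewrite -aD aE exprMn.
Qed.

(** With rho = b s - a t and t = x^M,
      t^2 (a^2 - D b^2) = b^2 (s^2 - D t^2) + rho (rho - 2 b s),
    where s^2 - D t^2 is small by the choice of s, and rho by that of a and b. The
    bound 2n <= M keeps the first term from exceeding the bound on the second. *)
Lemma size_norm_approx (F : fieldType) (D a b s : {poly F}) (d M n : nat) :
  (size s <= (M + d).+1)%N ->
  (size (s ^+ 2 - D * 'X^M ^+ 2)%R <= M + d)%N ->
  (n.*2 <= M)%N -> b != 0 -> (size b <= n.+1)%N ->
  (size (b * s - a * 'X^M)%R + n <= M)%N ->
  a ^+ 2 - D * b ^+ 2 != 0 ->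
  (size (a ^+ 2 - D * b ^+ 2)%R + n < d + size b)%N.
Proof.
move=> ss sD leM b0 sb srho Q0.
set rho := b * s - a * 'X^M in srho; set Q := a ^+ 2 - D * b ^+ 2 in Q0 *.
have b_gt0 : (0 < size b)%N by rewrite size_poly_gt0.
have QE : Q * 'X^(M.*2) =
    b * (b * (s ^+ 2 - D * 'X^M ^+ 2)) + rho * (rho - b * s - b * s).
  rewrite /Q /rho -muln2 exprM; ring.
have sbs : (size (b * s)%R <= M + d + size b)%N.
  by apply: leq_trans (leq_size_polyM (leqnn _) ss) _; lia.
have : (size (Q * 'X^(M.*2))%R <= M.*2 + d + size b - n.+1)%N.
  rewrite QE; apply: leq_size_polyD.
    apply: leq_trans (leq_size_polyM (leqnn _)
      (leq_size_polyM (leqnn _) sD)) _; lia.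
  have srho' : (size rho <= M - n)%N by lia.
  apply: leq_trans
    (leq_size_polyM srho' (_ : _ <= M + d + size b)%N) _; last lia.
  by apply: leq_size_polyB => //; apply: leq_size_polyB => //; lia.
by rewrite size_mulXn //; lia.
Qed.

(** * Pigeonholes for approximations *)

(** An approximation (a, b) of precision n falls into the hole (Q, B). Here Q is
    the norm, and the polynomial B stores both the residue P of a/b modulo Q and
    the defect r = n - deg b: as deg P < deg Q, the degree of B gives back r, and
    the lower part of B gives back P. *)
Variant approx_code (F : fieldType) (D s t : {poly F}) (n : nat)
    (Q B : {poly F}) : Prop :=
  ApproxCode (a b P : {poly F}) (r : nat) of
    b != 0 & (size b + r = n.+1)%N & (size (b * s - a * t)%R + n < size t)%N
    & Q = a ^+ 2 - D * b ^+ 2 & Q != 0 & Q %| a - P * b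
    & B = 'X^((size Q).-1 + r) + P & (size P < size Q)%N.

Lemma size_approx_code (F : fieldType) (Q P : {poly F}) (r : nat) :
  (size P < size Q)%N -> size ('X^((size Q).-1 + r) + P) = (size Q + r)%N.
Proof. by move=> PQ; rewrite size_polyDl size_polyXn; lia. Qed.

Lemma residue_exists (F : fieldType) (a b Q : {poly F}) :
  Q != 0 -> coprimep b Q ->
  exists P : {poly F}, Q %| a - P * b /\ (size P < size Q)%N.
Proof.
move=> Q0 /Bezout_eq1_coprimepP[[x y] /= xy1].
exists ((a * x) %% Q); split; last by rewrite ltn_modp.
have -> : (a * x) %% Q = a * x - (a * x) %/ Q * Q.
  by rewrite {2}(divp_eq (a * x) Q) addrC addKr.
have -> : a - (a * x - (a * x) %/ Q * Q) * b = (a * y + (a * x) %/ Q * b) * Q.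
  by rewrite -{1}[a]mulr1 -xy1; ring.
exact: dvdp_mull.
Qed.

Lemma approx_code_exists (F : fieldType) (D s : {poly F}) (d M n : nat) :
  ~ is_square D -> (size s <= (M + d).+1)%N ->
  (size (s ^+ 2 - D * 'X^M ^+ 2)%R <= M + d)%N -> (n.*2 <= M)%N ->
  exists QB : {poly F} * {poly F},
    [/\ approx_code D s 'X^M n QB.1 QB.2, (size QB.1 <= d)%N,
        (size QB.2 <= d)%N & QB.2 != 0].
Proof.
move=> Dsq ss sD leM.
have lt_n : (n < size ('X^M : {poly F}))%N by rewrite size_polyXn; lia.
have [a [b [b0 cab sb rho]]] := coprime_dirichlet_approx s lt_n.
pose Q : {poly F} := a ^+ 2 - D * b ^+ 2; pose r := (n.+1 - size b)%N.
have Q0 : Q != 0 by apply: norm_neq0.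
have sQ : (size Q + n < d + size b)%N.
  by apply: (size_norm_approx ss sD) => //; rewrite size_polyXn in rho.
have cbQ : coprimep b Q.
  have -> : Q = - D * b * b + a ^+ 2 by rewrite /Q; ring.
  by rewrite coprimep_addl_mul coprimep_pexpr // coprimep_sym.
have [P [QP sP]] := residue_exists a Q0 cbQ.
pose B : {poly F} := 'X^((size Q).-1 + r) + P.
have sB : size B = (size Q + r)%N := size_approx_code r sP.
have Q_gt0 : (0 < size Q)%N by rewrite size_poly_gt0.
have sQd : (size Q <= d)%N by lia.
have sBd : (size B <= d)%N by rewrite sB /r; lia.
exists (Q, B); split=> //.
- by apply: (@ApproxCode _ _ _ _ _ _ _ a b P r) => //; rewrite /r; lia.
- by rewrite -size_poly_gt0 sB; lia.
Qed.

(** The quotient of two elements a + b sqrt D and a' + b' sqrt D in the same hole.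
    Equality of the residues makes Q divide a' b - a b', and then Q divides
    a a' - D b b' by Brahmagupta's identity
      (a a' - D b b')^2 - D (a' b - a b')^2 = Q^2.
    Equality of the defects makes deg b - deg b' equal to n - n', which is not 0,
    whereas v = 0 would force b = u b' with u = 1 or u = -1. *)
Lemma approx_code_quotient (F : fieldType) (D s t : {poly F}) (n n' : nat)
    (Q B : {poly F}) :
  (n' < n)%N -> approx_code D s t n Q B -> approx_code D s t n' Q B ->
  exists u v : {poly F}, [/\ u ^+ 2 - D * v ^+ 2 = 1, v != 0
    & (size v <= n - n')%N].
Proof.
move=> lt_n [a b P r b0 sb rho Qab Q0 Qa BE sP].
move=> [a' b' P' r' b'0 sb' rho' Qab' _ Qa' BE' sP'].
have rr' : r = r'.
  by have := size_approx_code r sP; rewrite -BE BE' size_approx_code //; lia.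
have PP' : P = P' by move: BE'; rewrite BE rr' => /addrI.
rewrite -{}rr' -{}PP' {P' r' BE' sP'} in sb' Qa'.
have Qgt0 : (0 < size Q)%N by rewrite size_poly_gt0.
have [v vQ] : exists v : {poly F}, a' * b - a * b' = v * Q.
  apply/dvdpP.
  have -> : a' * b - a * b' = (a' - P * b') * b - (a - P * b) * b' by ring.
  by rewrite dvdp_sub // dvdp_mulr.
have brahmagupta : (a * a' - D * b * b') ^+ 2
    = Q ^+ 2 + D * (a' * b - a * b') ^+ 2.
  have -> : Q ^+ 2 = (a ^+ 2 - D * b ^+ 2) * (a' ^+ 2 - D * b' ^+ 2).
    by rewrite -Qab -Qab'.
  ring.
have [u uQ] : exists u : {poly F}, a * a' - D * b * b' = u * Q.
  apply/dvdpP.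
  rewrite -(@dvdp_pexp2r _ _ _ 2) // brahmagupta vQ exprMn mulrA.
  by rewrite dvdp_add // dvdp_mull.
have uv1 : u ^+ 2 - D * v ^+ 2 = 1.
  apply: (mulIf (expf_neq0 2 Q0)).
  have -> : (u ^+ 2 - D * v ^+ 2) * Q ^+ 2 = (u * Q) ^+ 2 - D * (v * Q) ^+ 2.
    by ring.
  by rewrite -uQ -vQ brahmagupta mul1r addrK.
(* The coefficient of sqrt D in (u + v sqrt D) (a' + b' sqrt D) = a + b sqrt D. *)
have bE : b = u * b' + v * a'.
  apply: (mulIf Q0); rewrite mulrDl.
  have -> : u * b' * Q = (u * Q) * b' by ring.
  have -> : v * a' * Q = (v * Q) * a' by ring.
  by rewrite -uQ -vQ Qab'; ring.
have v0 : v != 0.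
  apply/eqP => v0; move: uv1; rewrite v0 expr0n mulr0 subr0 => u2.
  have : size (u ^+ 2) = 1 by rewrite u2 size_poly1.
  have u0 : u != 0.
    by apply/eqP => u0; move/eqP: u2; rewrite u0 expr0n eq_sym oner_eq0.
  rewrite expr2 size_polyM // => su.
  have : size b = size b' by rewrite bE v0 mul0r addr0 size_polyM //; lia.
  by lia.
exists u, v; split=> //.
have t_gt0 : (0 < size t)%N by lia.
have t0 : t != 0 by rewrite -size_poly_gt0.
(* The main terms b b' s cancel: only the two approximation errors remain. *)
have tvE : t * (v * Q) = (b * s - a * t) * b' - (b' * s - a' * t) * b.
  by rewrite -vQ; ring.
have : (size (t * (v * Q))%R <= (size t - n'.+1 + (n.+1 - r)).-1)%N.
  rewrite tvE; apply: leq_size_polyB.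
    apply: leq_trans (leq_size_polyM (_ : _ <= size t - n.+1)%N
       (_ : _ <= n'.+1 - r)%N) _; lia.
  apply: leq_trans (leq_size_polyM (_ : _ <= size t - n'.+1)%N
       (_ : _ <= n.+1 - r)%N) _; lia.
rewrite !size_polyM ?mulf_neq0 //.
have := v0; rewrite -size_poly_gt0; lia.
Qed.

(** * Pell's equation *)

Lemma size_pell_solution (F : fieldType) (D u v : {poly F}) (d : nat) :
  size D = d.*2.+1 -> u ^+ 2 - D * v ^+ 2 = 1 -> v != 0 ->
  (size u <= d + size v)%N.
Proof.
move=> sizeD uv1 v0; have [->|u0] := eqVneq u 0; first by rewrite size_poly0.
have D0 : D != 0 by rewrite -size_poly_eq0 sizeD.
have u2 : u * u = 1 + D * (v * v) by rewrite -uv1; ring.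
have v_gt0 : (0 < size v)%N by rewrite size_poly_gt0.
have : (size (u * u)%R <= (d + size v).*2.-1)%N.
  rewrite u2; apply: leq_size_polyD; first by rewrite size_poly1; lia.
  by rewrite !size_polyM ?mulf_neq0 // sizeD; lia.
by rewrite size_polyM //; lia.
Qed.

(** There are q^d polynomials of degree less than d, of which q^d - 1 are
    nonzero. *)
Lemma poly_pair_pigeonhole (F : finFieldType) (d : nat)
    (f : 'I_(#|F| ^ d * (#|F| ^ d).-1).+1 -> {poly F} * {poly F}) :
  (forall i, [/\ size (f i).1 <= d, size (f i).2 <= d & (f i).2 != 0%R]%N) ->
  exists i j : 'I_(#|F| ^ d * (#|F| ^ d).-1).+1, (i < j)%N /\ f i = f j.
Proof.
move=> fP.
pose g i : 'rV[F]_d * 'rV[F]_d := (poly_rV (f i).1, poly_rV (f i).2).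
have [/injectiveP g_inj|] := boolP (injectiveb g).
  pose A := setX [set: 'rV[F]_d] [set~ (0 : 'rV[F]_d)].
  have : g @: setT \subset A.
    apply/subsetP => _ /imsetP[i _ ->]; have [_ s2 f20] := fP i.
    rewrite !inE /=; apply: contraNneq f20 => /(congr1 rVpoly).
    by rewrite poly_rV_K // linear0 => ->.
  move=> /subset_leq_card; rewrite card_imset // cardsT card_ord.
  by rewrite cardsX cardsT cardsC1 !card_mx mul1n ltnn.
case/injectivePn => i [j ij gij].
have fij : f i = f j.
  have [s1 s2 _] := fP i; have [s1' s2' _] := fP j.
  case: gij => /(congr1 rVpoly) e1 /(congr1 rVpoly) e2.
  rewrite !poly_rV_K // in e1 e2.
  exact: injective_projections.
case: (ltngtP i j) => [lt_ij|lt_ji|/val_inj eij].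
- by exists i, j.
- by exists j, i.
- by rewrite eij eqxx in ij.
Qed.

Lemma pell_solution (F : finFieldType) (D : {poly F}) (d : nat) :
  odd #|F| -> size D = d.*2.+1 -> is_square (lead_coef D) -> ~ is_square D ->
  let N := (#|F| ^ d * (#|F| ^ d).-1)%N in
  exists u v : {poly F},
    [/\ u ^+ 2 - D * v ^+ 2 = 1, v != 0, (size v <= N)%N
      & (size u <= d + N)%N].
Proof.
move=> oddF sizeD [c lcD] Dsq N.
(* The exponent of t = x^M: large enough for all precisions n <= N at once. *)
pose M := N.*2.
have D0 : D != 0 by rewrite -size_poly_eq0 sizeD.
have sE : size (D * 'X^M ^+ 2) = (M + d).*2.+1.
  by rewrite -exprM size_mulXn // sizeD; lia.
have lcE : lead_coef (D * 'X^M ^+ 2) = c ^+ 2.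
  by rewrite lead_coefM -exprM lead_coefXn mulr1.
have [s [ss sD]] := poly_sqrt_approx (two_neq0_odd_card oddF) sE lcE.
have codes (i : 'I_N.+1) : exists QB : {poly F} * {poly F},
    [/\ approx_code D s 'X^M i QB.1 QB.2, (size QB.1 <= d)%N,
        (size QB.2 <= d)%N & QB.2 != 0].
  apply: (approx_code_exists Dsq ss sD).
  by rewrite leq_double -ltnS.
have [f fP] := fin_all_exists codes.
have [|j [i [lt_ji fij]]] := @poly_pair_pigeonhole F d f.
  by move=> i; have [] := fP i.
have [ci _ _ _] := fP i; have [cj _ _ _] := fP j; rewrite fij in cj.
have [u [v [uv1 v0 sv]]] := approx_code_quotient lt_ji ci cj.
have leN : (size v <= N)%N by have := ltn_ord i; lia.
exists u, v; split=> //.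
have := size_pell_solution sizeD uv1 v0.
by move/leq_trans; apply; rewrite leq_add2l.
Qed.

Lemma pell_minus (F : finFieldType) (D : {poly F}) :
  positive D -> odd #|F| ->
  exists u v : {poly F},
       [/\ u ^+ 2 - D * v ^+ 2 = 1, v != 0,
           (deg u <= #|F| ^ deg D)%N & (deg v <= #|F| ^ deg D)%N].
Proof.
move=> [Dconst Dsq evenD lcD] oddF.
have D0 : D != 0 by apply/eqP => D0; apply: Dconst; exists 0; rewrite D0.
pose d := (deg D)./2.
have degD : deg D = d.*2 by rewrite even_halfK.
have sizeD : size D = d.*2.+1.
  by rewrite -degD /deg prednK // size_poly_gt0.
have [u [v [uv1 v0 sv su]]] := pell_solution oddF sizeD lcD Dsq.
have d_lt : (d < #|F| ^ d)%N by rewrite ltn_expl // finNzRing_gt1.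
rewrite degD -addnn expnD /deg.
(* deg u exceeds deg v by d, and q^d (q^d - 1) + d <= q^(2d) because d < q^d. *)
have deg_bound X m : (d < X -> m <= d + X * X.-1 -> m.-1 <= X * X)%N by nia.
exists u, v; split=> //; first exact: deg_bound d_lt su.
by apply: deg_bound d_lt (leq_trans sv _); rewrite leq_addl.
Qed.

Lemma nontrivial_solution (F : fieldType) (D u v : {poly F}) :
  ~ is_const D -> u ^+ 2 - D * v ^+ 2 = 1 -> v != 0 -> ~ trivial_solution u v.
Proof.
move=> Dconst uv1 v0 [[c uE] [e vE]].
have e0 : e ^+ 2 != 0 by move: v0; rewrite vE polyC_eq0 sqrf_eq0.
apply: Dconst; exists ((c ^+ 2 - 1) / e ^+ 2).
apply: (mulIf (_ : (e ^+ 2)%:P != 0)); first by rewrite polyC_eq0.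
rewrite -polyCM divfK // rmorphB !rmorphXn rmorph1 /= -uE -vE -[X in _ - X]uv1.
by ring.
Qed.

(* For positive D, the equation u^2 + D v^2 = 1 has only trivial solutions
   unless q = 1 mod 4: for q = 3 mod 4 the leading coefficients cannot cancel,
   and for q even (u + 1)^2 = D v^2 forces v = 0. The usual form
   u^2 - D v^2 = 1 has nontrivial solutions for every odd q. *)
Theorem theorem1p4 (F : finFieldType) (q : nat) (hq : #|F| = q)
    (D : {poly F}) (hD : positive D) :
  (odd q ->
     exists u v : {poly F},
       [/\ u ^+ 2 - D * v ^+ 2 = 1, ~ trivial_solution u v,
           (deg u <= q ^ deg D)%N & (deg v <= q ^ deg D)%N]) /\
  (q = 1 %[mod 4] ->
     exists u v : {poly F},
       [/\ u ^+ 2 + D * v ^+ 2 = 1, ~ trivial_solution u v,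
           (deg u <= q ^ deg D)%N & (deg v <= q ^ deg D)%N]).
Proof.
have [Dconst _ _ _] := hD.
rewrite -{}hq; split=> [oddF|F1mod4].
  have [u [v [uv1 v0 du dv]]] := pell_minus hD oddF.
  by exists u, v; split=> //; apply: nontrivial_solution uv1 v0.
have oddF : odd #|F| by lia.
have [i i2] := sqrt_opp1 F1mod4.
have i0 : i != 0 by rewrite -sqrf_eq0 i2 oppr_eq0 oner_eq0.
have [u [v [uv1 v0 du dv]]] := pell_minus hD oddF.
exists u, (i *: v); split=> //.
- by rewrite exprZn i2 scaleN1r mulrN.
- case=> uc [e ivE]; apply: (nontrivial_solution Dconst uv1 v0); split=> //.
  by exists (i^-1 * e); rewrite polyCM -ivE mul_polyC scalerA mulVf ?scale1r.
- by rewrite /deg size_scale.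
Qed.
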